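(* Algorithm $\texttt{t}_2\texttt{DTP()}$ (described in the context) is correct: on any input $\texttt{t}_2$DTN $\mathcal{N}_{\texttt{t}_2}=(\mathcal{T},\mathcal{C}_{\texttt{t}_1}\cup\mathcal{C}_{\texttt{t}_2})$ it returns a feasible schedule $\varphi:\mathcal{T}\to\mathbb{R}$ if $\mathcal{N}_{\texttt{t}_2}$ is consistent, and otherwise it recognizes $\mathcal{N}_{\texttt{t}_2}$ as inconsistent.
   Context: A $\texttt{t}_2$DTN is a pair $(\mathcal{T},\mathcal{C}_{\texttt{t}_1}\cup\mathcal{C}_{\texttt{t}_2})$, where $\mathcal{T}$ is a finite set of time-points, $\mathcal{C}_{\texttt{t}_1}$ is a finite set of simple constraints $(Y-X\le w_{X,Y})$ ($X,Y\in\mathcal{T}$, $w_{X,Y}\in\mathbb{R}$), and $\mathcal{C}_{\texttt{t}_2}$ a finite set of constraints $\bigvee_{i=1}^k(l_i\le X\le u_i)$ with $X\in\mathcal{T}$, $l_i,u_i\in\mathbb{R}$, whose disjuncts are ordered so that $l_i<l_{i+1}$ and $u_i<u_{i+1}$. A schedule $s:\mathcal{T}\to\mathbb{R}$ is feasible if it satisfies all constraints; the network is consistent if one exists. For an STN $(\mathcal{T},\mathcal{C}_{\texttt{t}_1})$ (viewed as a weighted digraph with arc $(X,Y)$ of weight $w_{X,Y}$ per constraint), the least feasible schedule is the non-negative feasible schedule that is pointwise $\le$ every non-negative feasible schedule; for a schedule $\varphi$, $\delta^{\varphi}_X(T)$ denotes the shortest-path length from $T$ to $X$ under reduced weights $w_{A,B}-\varphi(B)+\varphi(A)$.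 Algorithm $\texttt{t}_2\texttt{DTP()}$: (1) Solve the STN $(\mathcal{T},\mathcal{C}_{\texttt{t}_1})$ (Bellman–Ford); if inconsistent, report inconsistency; else let $\hat\varphi$ be its least feasible schedule. (2) For each $X$ occurring in a $\texttt{t}_2$-constraint compute $\delta^{\hat\varphi}_X(T)$ for all $T\in\mathcal{T}$ (Dijkstra on the reversed graph with reduced weights). (3) Set $f\leftarrow\hat\varphi$. While there exist $X$ and $c_X=\bigvee_{i=1}^k(l_i\le X\le u_i)\in\mathcal{C}_{\texttt{t}_2}$ not satisfied by $f(X)$: if $f(X)>u_k$ report inconsistency; otherwise let $i^*$ be the smallest $i$ with $f(X)<l_i$, set $\delta^f_X(T)\leftarrow\delta^{\hat\varphi}_X(T)+(f(T)-\hat\varphi(T))-(f(X)-\hat\varphi(X))$ for all $T\in\mathcal{T}$, and then $f(T)\leftarrow f(T)+\max(0,l_{i^*}-f(X)-\delta^f_X(T))$ for all $T\in\mathcal{T}$. (4) When the loop exits, return $f$.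
   Formalization: Consistent is taken to mean that a feasible schedule with non-negative values exists; with arbitrary real schedules the claim fails, e.g. for the single constraint -2 ≤ X ≤ -1, where the least non-negative schedule gives X = 0 and the algorithm reports inconsistency. *)

(* Defs.v *)
From mathcomp Require Import all_boot all_order all_algebra.
From mathcomp Require Import all_classical all_reals ereal.
From Stdlib Require Import Relation_Operators.

Set Implicit Arguments.
Unset Strict Implicit.
Unset Printing Implicit Defensive.

Import Order.TTheory GRing.Theory Num.Theory.
Local Open Scope classical_set_scope.
Local Open Scope ring_scope.

Section Networks.
Variables (R : realType) (T : finType).

(* A pair (X, [:: (l_1, u_1); ...; (l_k, u_k)]) encodes the disjunction of the
   l_i <= X <= u_i.  The algorithm refers to u_k, so k >= 1; the individual
   intervals may be empty (l_i > u_i). *)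
Definition disjuncts_ordered (D : seq (R * R)) : bool :=
  (D != [::]) && sorted (fun p q => (p.1 < q.1) && (p.2 < q.2)) D.

(* (X, Y, w) \in t1con N encodes Y - X <= w, that is, an arc from X to Y of
   weight w.  Several constraints on the same pair, or several disjunctions on
   the same time-point, are allowed. *)
Record t2dtn := T2DTN {
  t1con : seq (T * T * R);
  t2con : seq (T * seq (R * R));
  t2con_ordered : forall c, c \in t2con -> disjuncts_ordered c.2 }.

Variable N : t2dtn.
Implicit Types (s phi f : T -> R) (c : T * seq (R * R)).

Definition stn_feasible s : Prop :=
  forall X Y w, (X, Y, w) \in t1con N -> s Y - s X <= w.

Definition t2_sat s c : bool := has (fun p => p.1 <= s c.1 <= p.2) c.2.

Definition feasible s : Prop :=
  stn_feasible s /\ forall c, c \in t2con N -> t2_sat s c.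

Definition nonneg s : Prop := forall X, 0 <= s X.

(* The time axis starts at 0.  This matters because t2-constraints are not
   invariant under translation, whereas the algorithm starts from the least
   non-negative schedule: over all of R, the network whose only constraint is
   -2 <= X <= -1 has a feasible schedule, yet the algorithm rejects it. *)
Definition consistent : Prop := exists s, nonneg s /\ feasible s.

Definition least_feasible phi : Prop :=
  [/\ nonneg phi, stn_feasible phi &
      forall s, nonneg s -> stn_feasible s -> forall X, phi X <= s X].

(* [walk phi A B d]: some directed walk from A to B has length d for the reduced
   weights w - phi B + phi A. *)
Inductive walk phi : T -> T -> R -> Prop :=
| walk_nil A : walk phi A A 0
| walk_cons A B C w d : (A, B, w) \in t1con N -> walk phi B C d ->
    walk phi A C ((w - phi B + phi A) + d).

(* The distance delta^phi_X(A) from A to X; it is +oo when X is not reachable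
   from A. *)
Definition delta phi (X A : T) : \bar R :=
  ereal_inf [set d%:E | d in [set d | walk phi A X d]].

(* delta^f_X(A), obtained from the distances delta^phi_X(A). *)
Definition delta_update phi f (X A : T) : \bar R :=
  (delta phi X A + (f A - phi A)%:E - (f X - phi X)%:E)%E.

(* [fine] is applied to a finite value: an infinite distance contributes
   max(0, -oo) = 0. *)
Definition raise phi f (X : T) (l : R) : T -> R := fun A =>
  f A + fine (Order.max 0 ((l - f X)%:E - delta_update phi f X A))%E.

Inductive state :=
| Start
| Loop of (T -> R) & (T -> R)
| Returned of (T -> R)
| Inconsistent.

(* Small-step semantics.  In [Loop phi f], phi is the least feasible schedule of
   the STN and f the current schedule.  The choice of a violated constraint is
   nondeterministic; the two classical subroutines (Bellman-Ford, Dijkstra) are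
   represented by the values they compute. *)
Inductive step : state -> state -> Prop :=
| step_stn_inconsistent :
    ~ (exists s, stn_feasible s) -> step Start Inconsistent
| step_stn_solved phi :
    least_feasible phi -> step Start (Loop phi phi)
| step_reject phi f c :
    c \in t2con N -> ~~ t2_sat f c -> (last (0, 0) c.2).2 < f c.1 ->
    step (Loop phi f) Inconsistent
| step_raise phi f c i :
    c \in t2con N -> ~~ t2_sat f c -> f c.1 <= (last (0, 0) c.2).2 ->
    (i < size c.2)%N -> f c.1 < (nth (0, 0) c.2 i).1 ->
    (forall j, (j < i)%N -> (nth (0, 0) c.2 j).1 <= f c.1) ->
    step (Loop phi f) (Loop phi (raise phi f c.1 (nth (0, 0) c.2 i).1))
| step_return phi f :
    (forall c, c \in t2con N -> t2_sat f c) ->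
    step (Loop phi f) (Returned f).

Definition terminates : Prop := Acc (fun st' st => step st st') Start.

(* Final states are the states without successor, so a run that got stuck in
   [Start] or in [Loop] would count as an outcome too. *)
Definition outcome (st : state) : Prop :=
  clos_refl_trans_1n state step Start st /\ forall st', ~ step st st'.

End Networks.

Arguments Start {R T}.
Arguments Loop {R T}.
Arguments Returned {R T}.
Arguments Inconsistent {R T}.

(* Main.v *)
Require Import Defs.
From mathcomp Require Import all_boot all_order all_algebra.
From mathcomp Require Import all_classical all_reals ereal.
From mathcomp Require Import lra.

(** Unfolding the reduced weights, a raise of [X] to [l] sets every [f A] to
    the maximum of [f A] and [l - D(A, X)], where [D] is the distance for the
    original weights.  This keeps [f] feasible for the simple constraints, and
    it keeps [f] below every non-negative feasible schedule [s]: as [f <= s],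
    every disjunct before the [i]-th ends before [f X <= s X], so that
    [s X >= l_i].  Hence a rejection is justified, and so is a returned
    schedule.  Every raise lifts some [f X] past some bound [l_i] while no value
    ever decreases, so the number of pairs [(X, l_i)] with [f X < l_i] strictly
    decreases.  The least schedule of a solvable STN is the pointwise infimum
    of its non-negative feasible schedules. *)

Set Implicit Arguments.
Unset Strict Implicit.
Unset Printing Implicit Defensive.

Import Order.TTheory GRing.Theory Num.Theory.
Local Open Scope classical_set_scope.
Local Open Scope ring_scope.

Lemma ltn_count (A : eqType) (P Q : pred A) (s : seq A) (x : A) :
  subpred P Q -> x \in s -> Q x -> ~~ P x -> (count P s < count Q s)%N.
Proof.
move=> PQ + Qx Px; elim: s => // y s IHs; rewrite inE => /orP[/eqP <-|/IHs lt_s].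
  by rewrite /= Qx (negbTE Px) add0n add1n ltnS; exact: sub_count.
rewrite /= -addnS leq_add //.
by case Py: (P y) => //; rewrite (PQ _ Py).
Qed.

(** * Reduced distances and the effect of one raise *)

Section Distances.
Context {R : realType} {T : finType} {N : t2dtn R T}.
Implicit Types (phi f s : T -> R) (A B X : T).

(** Telescoping: feasibility of [s] bounds the increase of [s - phi] along each arc by its reduced
    weight. *)
Lemma walk_potential phi s A X d : stn_feasible N s -> walk N phi A X d ->
  (s X - phi X) - (s A - phi A) <= d.
Proof.
move=> sP; elim=> {A X d} [A|A B X w d ABw _ IH]; first by rewrite subrr.
by have := sP _ _ _ ABw; lra.
Qed.

Lemma delta_potential phi s A X : stn_feasible N s ->
  (((s X - phi X) - (s A - phi A))%:E <= delta N phi X A)%E.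
Proof.
move=> sP; apply: le_ereal_inf_tmp => _ [d /= dP <-].
by rewrite lee_fin; exact: walk_potential dP.
Qed.

(** The case [s = phi] of the preceding bound. It excludes [-oo], so each distance is a non-negative
    real or [+oo]. *)
Lemma delta_ge0 phi A X : stn_feasible N phi -> (0 <= delta N phi X A)%E.
Proof. by move=> /delta_potential -/(_ phi A X); rewrite !subrr. Qed.

Lemma delta_refl phi X : stn_feasible N phi -> delta N phi X X = 0%E.
Proof.
move=> phiP; apply/eqP; rewrite eq_le delta_ge0 // andbT.
by apply: ereal_inf_lbound; exists 0 => //; exact: walk_nil.
Qed.

(** Triangle inequality: the arc can be prepended to every walk from [B] to [X]. *)
Lemma delta_arc phi A B X w : (A, B, w) \in t1con N ->
  (delta N phi X A <= (w - phi B + phi A)%:E + delta N phi X B)%E.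
Proof.
move=> ABw; rewrite -leeBlDl //; apply: le_ereal_inf_tmp => _ [d dP <-].
rewrite leeBlDl // -EFinD; apply: ereal_inf_lbound.
by exists (w - phi B + phi A + d) => //; exact: walk_cons dP.
Qed.

Lemma raise_pinfty phi f X l A : delta N phi X A = +oo%E ->
  raise N phi f X l A = f A.
Proof. by move=> e; rewrite /raise /delta_update e /= addr0. Qed.

(** The corrections by [f] cancel; [r - phi A + phi X] is the distance for the original weights. *)
Lemma raise_fin phi f X l A r : delta N phi X A = r%:E ->
  raise N phi f X l A = Num.max (f A) (l - r + phi A - phi X).
Proof.
move=> e; rewrite /raise /delta_update e /= -EFin_max /= addr_maxr addr0.
by congr Num.max; lra.
Qed.

Lemma raise_ge phi f X l A : stn_feasible N phi -> f A <= raise N phi f X l A.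
Proof.
case/(delta_ge0 A X)/gee0P => [/raise_pinfty->//|[r _ /raise_fin->]].
by rewrite le_max lexx.
Qed.

Lemma raise_target phi f X l : stn_feasible N phi -> l <= raise N phi f X l X.
Proof.
move=> /(delta_refl X)/raise_fin ->.
by rewrite le_max subr0 addrK lexx orbT.
Qed.

Lemma raise_stn_feasible phi f X l : stn_feasible N phi -> stn_feasible N f ->
  stn_feasible N (raise N phi f X l).
Proof.
move=> phiP fP A B w ABw.
have fw := fP _ _ _ ABw; have geA := raise_ge f X l A phiP.
(* If [X] is unreachable from [B], the value at [B] stays and that at [A] does not drop. Otherwise
   the arc makes [X] reachable from [A] too. *)
have /gee0P[eB|[r _ eB]] := delta_ge0 B X phiP; first by rewrite (raise_pinfty _ _ eB); lra.
have := delta_arc phi X ABw; rewrite eB.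
have /gee0P[->//|[q _ eA]] := delta_ge0 A X phiP.
rewrite eA -EFinD lee_fin => qr.
rewrite (raise_fin _ _ eB) lerBlDr ge_max; apply/andP; split; first by lra.
by rewrite (raise_fin _ _ eA) -lerBlDl le_max; apply/orP; right; lra.
Qed.

(** From [A] to [X], [s] grows by at most the original distance, so [l <= s X] forces [s A] to be at
    least [l] minus that distance. *)
Lemma raise_le phi f s X l : stn_feasible N phi -> stn_feasible N s ->
  (forall A, f A <= s A) -> l <= s X -> forall A, raise N phi f X l A <= s A.
Proof.
move=> phiP sP fs lX A; have /gee0P[/raise_pinfty->//|[r _ e]] := delta_ge0 A X phiP.
have := delta_potential phi A X sP; rewrite e lee_fin => sr.
by rewrite (raise_fin _ _ e) ge_max fs; lra.
Qed.

End Distances.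

(** * Ordered disjunctions *)

Section Disjunctions.
Context {R : realType}.
Implicit Types (D : seq (R * R)) (x y : R).

Lemma disjuncts_le D i j : disjuncts_ordered D -> (i <= j < size D)%N ->
  (nth (0, 0) D i).1 <= (nth (0, 0) D j).1 /\
  (nth (0, 0) D i).2 <= (nth (0, 0) D j).2.
Proof.
move=> /andP[_ sD] /andP[ij jD].
have tr : transitive (fun p q : R * R => (p.1 < q.1) && (p.2 < q.2)).
  move=> q p r /andP[pq1 pq2] /andP[qr1 qr2].
  by rewrite (lt_trans pq1 qr1) (lt_trans pq2 qr2).
move: ij; rewrite leq_eqVlt => /orP[/eqP->//|ij].
by have /andP[/ltW ? /ltW ?] :=
  sorted_ltn_nth tr (0, 0) sD i j (ltn_trans ij jD) jD ij.
Qed.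

Lemma disjunct_le_last D p : disjuncts_ordered D -> p \in D ->
  p.2 <= (last (0, 0) D).2.
Proof.
move=> oD /(nthP (0, 0))[j jD <-]; rewrite -nth_last.
have D0 : (0 < size D)%N by exact: leq_ltn_trans jD.
by apply: (disjuncts_le oD _).2; rewrite prednK // leqnn andbT -ltnS prednK.
Qed.

Lemma violated_next_disjunct D x : disjuncts_ordered D ->
  ~~ has (fun p => p.1 <= x <= p.2) D -> x <= (last (0, 0) D).2 ->
  exists i, [/\ (i < size D)%N, x < (nth (0, 0) D i).1 &
    forall j, (j < i)%N -> (nth (0, 0) D j).1 <= x].
Proof.
move=> /andP[D0 _] vD xu.
(* The last disjunct is a witness: [x] violates it without exceeding its upper bound. *)
have hasl : has (fun p => x < p.1) D.
  have lastD : last (0, 0) D \in D.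
    by move: D0; case: (D) => [|p D' _] //=; rewrite mem_last.
  apply/hasP; exists (last (0, 0) D) => //; rewrite ltNge; apply/negP => lx.
  by move/hasPn: vD => /(_ _ lastD); rewrite lx xu.
exists (find (fun p => x < p.1) D); split; first by rewrite -has_find.
  exact: (nth_find (0, 0) hasl).
by move=> j /(before_find (0, 0)) /negbT; rewrite -leNgt.
Qed.

(** A disjunct before the [i]-th starts at or below [x] but misses [x], so it ends before [x <= y].
    Hence [y] lies in the [i]-th or a later one. *)
Lemma satisfied_ge D x y i : disjuncts_ordered D ->
  ~~ has (fun p => p.1 <= x <= p.2) D ->
  (forall j, (j < i)%N -> (nth (0, 0) D j).1 <= x) ->
  x <= y -> has (fun p => p.1 <= y <= p.2) D -> (nth (0, 0) D i).1 <= y.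
Proof.
move=> oD vD lx xy /(has_nthP (0, 0))[j jD /andP[ly yu]].
have [ij|ji] := leqP i j.
  by apply: le_trans ly; apply: (disjuncts_le oD _).1; rewrite ij.
move/hasPn: vD => /(_ _ (mem_nth (0, 0) jD)).
by rewrite lx //= (le_trans xy yu).
Qed.

End Disjunctions.

(** * Least schedule, progress and invariant *)

Section Correctness.
Context {R : realType} {T : finType}.
Variable N : t2dtn R T.
Implicit Types (phi f s : T -> R) (st : state R T).

Lemma least_feasible_exists :
  (exists s, stn_feasible N s) -> exists phi, least_feasible N phi.
Proof.
move=> [s0 s0P].
pose S X := [set s X | s in [set s | nonneg s /\ stn_feasible N s]].
have S0 X : S X !=set0.
  (* Simple constraints are translation invariant, and a shift by [m >= |s0 A|] makes every value
     non-negative. *)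
  pose m := \sum_(A : T) `|s0 A|.
  exists (s0 X + m), (fun A => s0 A + m) => //=; split => [A|A B w /s0P]; last lra.
  have : `|s0 A| <= m by rewrite /m (bigD1 A) //= lerDl sumr_ge0.
  by have := ler_norm (- s0 A); rewrite normrN; lra.
have lbS X : lbound (S X) 0 by move=> _ [s [s_ge0 _] <-].
have infS s X : nonneg s -> stn_feasible N s -> inf (S X) <= s X.
  by move=> s_ge0 sP; apply: ge_inf; [exists 0; exact: lbS | exists s].
exists (fun X => inf (S X)); split=> [X|A B w ABw|s s_ge0 sP X].
- exact: lb_le_inf.
(* Each admissible [s] gives [inf (S B) - w <= s B - w <= s A]. *)
- rewrite lerBlDr -lerBlDl; apply: lb_le_inf => // _ [s [s_ge0 sP] <-].
  by have := sP _ _ _ ABw; have := infS s B s_ge0 sP; lra.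
- exact: infS.
Qed.

(** Together with the next lemma: no run gets stuck before [Returned] or [Inconsistent]. *)
Lemma progress_Start : exists st, step N Start st.
Proof.
have [/least_feasible_exists[phi phiP]|nfeas] := pselect (exists s, stn_feasible N s).
  by exists (Loop phi phi); exact: step_stn_solved.
by exists Inconsistent; exact: step_stn_inconsistent.
Qed.

Lemma progress_Loop phi f : exists st, step N (Loop phi f) st.
Proof.
have [/allP sat|/allPn[c cN vc]] := boolP (all (t2_sat f) (t2con N)).
  by exists (Returned f); exact: step_return.
have [uf|fu] := ltP (last (0, 0) c.2).2 (f c.1).
  by exists Inconsistent; exact: step_reject uf.
have [i [iD fl lf]] := violated_next_disjunct (t2con_ordered cN) vc fu.
by exists (Loop phi (raise N phi f c.1 (nth (0, 0) c.2 i).1)); exact: step_raise.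
Qed.

(** The clauses for final states are the correctness claims; rejections rest on the last clause of
    [Loop]. *)
Definition invariant st : Prop :=
  match st with
  | Start => True
  | Loop phi f => [/\ stn_feasible N phi, nonneg f, stn_feasible N f &
      forall s, nonneg s -> feasible N s -> forall X, f X <= s X]
  | Returned f => nonneg f /\ feasible N f
  | Inconsistent => ~ consistent N
  end.

Lemma invariant_step st st' : step N st st' -> invariant st -> invariant st'.
Proof.
case=> {st st'} /=.
- by move=> nfeas _ [s [_ [sP _]]]; apply: nfeas; exists s.
- move=> phi [phi_ge0 phiP phi_min] _; split=> // s s_ge0 [sP _].
  exact: phi_min.
- move=> phi f c cN vc uf [_ _ _ f_min] [s [s_ge0 sP]].
  have /hasP[p pD /andP[_ su]] := sP.2 _ cN.
  have := disjunct_le_last (t2con_ordered cN) pD.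
  by have := f_min _ s_ge0 sP c.1; lra.
- move=> phi f c i cN vc _ iD fl lf [phiP f_ge0 fP f_min]; split=> //.
  + by move=> A; exact: le_trans (f_ge0 A) (raise_ge _ _ _ _ phiP).
  + exact: raise_stn_feasible.
  + move=> s s_ge0 sP; have fs := f_min _ s_ge0 sP.
    apply: raise_le => //; first exact: sP.1.
    exact: satisfied_ge (t2con_ordered cN) vc lf (fs _) (sP.2 _ cN).
- by move=> phi f sat [_ f_ge0 fP _].
Qed.

Lemma outcome_invariant st : outcome N st -> invariant st.
Proof.
move=> [run _]; have : invariant Start by [].
by elim: run => // st1 st2 st3 /invariant_step st12 _ IH /st12.
Qed.

Lemma outcome_final st : outcome N st ->
  st = Inconsistent \/ exists phi, st = Returned phi.
Proof.
case: st => [|phi f|phi|] [_ final]; last by left.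
- by have [st /final] := progress_Start.
- by have [st /final] := progress_Loop phi f.
- by right; exists phi.
Qed.

(** * Termination *)

Definition bounds : seq (T * R) := [seq (c.1, p.1) | c <- t2con N, p <- c.2].

Definition pending f : nat := count (fun b => f b.1 < b.2) bounds.

Lemma pending_raise phi f X l : stn_feasible N phi -> (X, l) \in bounds ->
  f X < l -> (pending (raise N phi f X l) < pending f)%N.
Proof.
move=> phiP Xl fl; apply: ltn_count Xl _ _ => //=.
  by move=> b; apply: le_lt_trans; exact: raise_ge.
by rewrite -leNgt raise_target.
Qed.

Notation stops := (Acc (fun st' st => step N st st')).

Lemma stops_Inconsistent : stops Inconsistent.
Proof. by constructor=> st H; inversion H. Qed.

Lemma stops_Returned f : stops (Returned f).
Proof. by constructor=> st H; inversion H. Qed.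

(** Induction on a strict upper bound of [pending f], since one raise may lower it by more than
    one. *)
Lemma stops_Loop phi f : stn_feasible N phi -> stops (Loop phi f).
Proof.
move=> phiP; have [n] := ubnP (pending f).
elim: n f => [|n IHn] f; first by rewrite ltn0.
rewrite ltnS => fn; constructor=> st H.
inversion H as [| |phi' f' c cN|phi' f' c i cN _ _ iD fl _|]; subst.
- exact: stops_Inconsistent.
- apply: IHn; apply: leq_trans fn; apply: pending_raise => //.
  apply/allpairsPdep; exists c, (nth (0, 0) c.2 i); split=> //; exact: mem_nth.
- exact: stops_Returned.
Qed.

Lemma algorithm_terminates : terminates N.
Proof.
constructor=> st H; inversion H as [|phi [_ phiP _]| | |]; subst.
- exact: stops_Inconsistent.
- exact: stops_Loop.
Qed.

End Correctness.

Theorem theorem5 (R : realType) (T : finType) (N : t2dtn R T) :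
  terminates N /\
  (consistent N -> forall st, outcome N st ->
     exists phi : T -> R, [/\ st = Returned phi, nonneg phi & feasible N phi]) /\
  (~ consistent N -> forall st, outcome N st -> st = Inconsistent).
Proof.
split; first exact: algorithm_terminates.
split=> consN st stP; have := outcome_invariant stP.
  case: (outcome_final stP) => [->//|[phi ->] [phi_ge0 phiP]].
  by exists phi.
case: (outcome_final stP) => [//|[phi ->] [phi_ge0 phiP]].
by case: consN; exists phi.
Qed.
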